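(* Let $f \in L^1(\mathbb{R})$ be a simple function (i.e. a measurable function taking only finitely many values). Let $x\in\mathbb{R}$ be a point at which $\mathcal{M}f$ is discontinuous. Then for every $r>0$, there exists $y\in (x-r,x+r)$ such that $\mathcal{T}f(y)=0$.
   Context: For $f\in L^1(\mathbb{R})$, $x\in\mathbb{R}$ and $r>0$, put $\mathcal{A}_r f(x):=\frac{1}{2r}\int_{-r}^{r} f(x+y)\,dy$. The (centered) Hardy-Littlewood maximal function is $\mathcal{M}f(x):=\sup_{r>0}\mathcal{A}_r|f|(x)\in[0,\infty]$. Put $E_{f,x}:=\{r>0:\mathcal{M}f(x)=\mathcal{A}_r|f|(x)\}$. The frequency function of $f$ is $\mathcal{T}f(x):=\inf E_{f,x}$ if $E_{f,x}$ is nonempty, and $\mathcal{T}f(x):=0$ otherwise. *)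

(* Defs.v *)
From HB Require Import structures.
From mathcomp Require Import all_boot all_order all_algebra.
From mathcomp Require Import all_classical all_reals all_analysis.

Set Implicit Arguments.
Unset Strict Implicit.
Unset Printing Implicit Defensive.

Import Order.TTheory GRing.Theory Num.Theory.
Import numFieldNormedType.Exports.

Local Open Scope classical_set_scope.
Local Open Scope ring_scope.

(* The carrier of [completed_lebesgue_measure]: convertible to [R], with the
   sigma-algebra of all Lebesgue-measurable (not only Borel) sets. *)
Notation lebesgueR R := (caratheodory_type (@wlength R idfun)^*%mu).

Section frequency_function.
Context {R : realType}.
Implicit Types (f : R -> R) (x r : R).

Definition avg r f x : \bar R :=
  (((2 * r)^-1)%R%:E *
   \int[@completed_lebesgue_measure R]_(y in `[(- r)%R, r]) (f (x + y)%R)%:E)%E.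

Definition maximal f x : \bar R :=
  ereal_sup [set avg r (fun z => `|f z|) x | r in [set r : R | 0 < r]].

Definition maximizing_radii f x : set R :=
  [set r | 0 < r /\ maximal f x = avg r (fun z => `|f z|) x].

Definition frequency f x : R :=
  if pselect (maximizing_radii f x !=set0) then inf (maximizing_radii f x)
  else 0.

End frequency_function.

(* Main.v *)
Require Import Defs.
From HB Require Import structures.
From mathcomp Require Import all_boot all_order all_algebra.
From mathcomp Require Import all_classical all_reals all_analysis.
From mathcomp Require Import measurable_realfun ring lra.

Set Implicit Arguments.
Unset Strict Implicit.
Unset Printing Implicit Defensive.

Import Order.TTheory GRing.Theory Num.Theory.
Import numFieldNormedType.Exports HBSimple.

Local Open Scope classical_set_scope.
Local Open Scope ring_scope.

(** Write g = |f| and let M be the maximal function of f. The average at y of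
    radius r is that of g over the closed interval [y - r, y + r].

    Since g takes finitely many values, there is a largest value c which g
    takes on a set of positive measure in every neighbourhood of x; then
    g <= c almost everywhere on some interval [x - d, x + d]
    (lemma [exists_local_top_value]).

    If M x were at least c, then M would be continuous at x
    (lemma [maximal_continuous]): near x, averages of small radius are at most
    c <= M x, and averages of radius at least d / 2 vary little with the
    centre, uniformly in the radius, because g is bounded. The remaining half,
    lower semicontinuity, holds everywhere. So a discontinuity of M at x forces
    M x < c.

    The set where g = c has density points arbitrarily close to x, and
    M y >= c at each of them (lemma [maximal_ge_near]). At such a point y, large
    radii give averages below c, as they do at x, and small radii give averages
    at most c. Hence M y = c, and this value can only be attained at small
    radii. If it is attained at r, then g = c almost everywhere on the interval
    of radius r about y, so it is attained at every smaller radius too: the set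
    of maximizing radii is empty or has infimum 0
    (lemma [frequency_eq0]). *)

(** * Translation invariance of the completed Lebesgue measure *)

Section translation.
Context {R : realType}.
Implicit Types (t : R) (A : set R).
Local Notation mu := (@completed_lebesgue_measure R).
Local Notation outer := ((@wlength R idfun)^*)%mu.

Lemma preimage_add_itvoc t (a b : R) :
  +%R t @^-1` `]a, b]%classic = `](a - t), (b - t)]%classic.
Proof.
by apply/seteqP; split => y /=; rewrite !in_itv/= => /andP[ay yb];
  apply/andP; split; lra.
Qed.

(** A half-open cover of A pulls back to a half-open cover of the preimage with
    the same lengths. *)
Lemma outer_preimage_add_le t A : (outer (+%R t @^-1` A) <= outer A)%E.
Proof.
apply: le_ereal_inf_tmp => _ [F [mF AF] <-].
apply: ereal_inf_lbound.
exists (fun i => +%R t @^-1` F i).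
  split=> [i|].
    have [[a b] _ <-] := mF i; rewrite preimage_add_itvoc.
    exact: is_ocitv.
  by move=> y /= /AF[i _ ?]; exists i.
apply: eq_eseriesr => i _.
have [[a b] _ <-] := mF i; rewrite preimage_add_itvoc.
rewrite !wlength_itv/= !lte_fin ltrD2r.
by case: ifP => // _; congr (_%:E); lra.
Qed.

Lemma outer_preimage_add t A : outer (+%R t @^-1` A) = outer A.
Proof.
apply/eqP; rewrite eq_le outer_preimage_add_le/=.
rewrite [in leLHS](_ : A = +%R (- t) @^-1` (+%R t @^-1` A)).
  exact: outer_preimage_add_le.
by apply/seteqP; split => y /=; rewrite addNKr || rewrite addrA subrr add0r.
Qed.

(** Caratheodory's criterion only mentions the outer measure, so it inherits
    the translation invariance of the latter. *)
Lemma measurable_add_completed t :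
  measurable_fun setT (+%R t : lebesgueR R -> lebesgueR R).
Proof.
move=> _ A mA; rewrite setTI.
suff : caratheodory_measurable outer (+%R t @^-1` A) by [].
have {}mA : caratheodory_measurable outer A by [].
move=> X; rewrite -(outer_preimage_add (- t) X) mA -(outer_preimage_add t).
rewrite -[Z in (_ + Z)%E](outer_preimage_add t).
congr (outer _ + outer _)%E; apply/seteqP; split => y /=; rewrite addKr //.
Qed.

Lemma integral_completed_translate t (D : set (lebesgueR R))
    (g : lebesgueR R -> \bar R) :
  measurable D -> measurable_fun D g -> (forall y, 0 <= g y)%E ->
  (\int[mu]_(y in +%R t @^-1` D) g (t + y)%R = \int[mu]_(y in D) g y)%E.
Proof.
move=> mD mg g0.
have E : pushforward mu (+%R t : lebesgueR R -> lebesgueR R) = mu.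
  by apply/funext => A; exact: outer_preimage_add.
rewrite -[in RHS]E.
by rewrite (ge0_integral_pushforward (measurable_add_completed t)).
Qed.

End translation.

(** * Integrals over centered intervals *)

Lemma itvcc_center_sub {R : realFieldType} (x y r s : R) :
  `|x - y| + r <= s -> `[x - r, x + r] `<=` `[y - s, y + s].
Proof.
rewrite -lerBrDr ler_distlC => /andP[h1 h2] z /=.
rewrite !in_itv/= => /andP[z1 z2].
by apply/andP; split; lra.
Qed.

Section mass.
Context {R : realType}.
Implicit Types (a b c r s x y : R) (A D : set (lebesgueR R)).
Local Notation mu := (@completed_lebesgue_measure R).

Lemma measurable_borel_completed (A : set (measurableTypeR R)) :
  measurable A -> measurable (A : set (lebesgueR R)).
Proof. exact: sub_caratheodory. Qed.

Lemma measurable_itv_completed (i : interval R) :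
  measurable ([set` i] : set (lebesgueR R)).
Proof. by apply: measurable_borel_completed; exact: measurable_itv. Qed.

Lemma completed_measure_itvcc a b : a <= b -> mu `[a, b]%classic = (b - a)%:E.
Proof.
move=> ab; change (lebesgue_measure `[a, b]%classic = (b - a)%:E).
rewrite lebesgue_measure_itv/= lte_fin -EFinB; case: ltP => // ba.
by congr EFin; lra.
Qed.

Variables (g : lebesgueR R -> R) (C : R).
Hypotheses (mg : measurable_fun setT g).
Hypotheses (g0 : forall y, 0 <= g y) (gC : forall y, g y <= C).

Definition mass x r : R :=
  fine (\int[mu]_(y in `[(x - r)%R, (x + r)%R]) (g y)%:E).

(** The single estimate behind all bounds on averages: with A empty it bounds
    an integral, and with A a smaller interval it compares two radii. *)
Lemma integral_le_enlarge c A D :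
  measurable A -> measurable D -> A `<=` D -> 0 <= c ->
  mu.-negligible (D `&` [set y | c < g y]) ->
  (\int[mu]_(y in D) (g y)%:E <=
   \int[mu]_(y in A) (g y)%:E + c%:E * mu (D `\` A))%E.
Proof.
move=> mA mD AD c0 gc; have mDA : measurable (D `\` A) by exact: measurableD.
have mgE B : measurable_fun B (EFin \o g).
  by apply/measurable_EFinP; exact: measurable_funTS.
rewrite -[in leLHS](setDUK AD) ge0_integral_setU//; last 2 first.
- by move=> y _; rewrite lee_fin.
- by apply/disj_setPS => y [? []].
rewrite leeD2l// -integral_cst//.
apply: ae_ge0_le_integral => //.
  by move=> y _; rewrite lee_fin.
apply: negligibleS gc => y /=; apply: contra_notP => h [Dy _].
by rewrite lee_fin leNgt; apply/negP => cg; exact: h.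
Qed.

Lemma integral_le_bound c D : measurable D -> 0 <= c ->
  mu.-negligible (D `&` [set y | c < g y]) ->
  (\int[mu]_(y in D) (g y)%:E <= c%:E * mu D)%E.
Proof.
move=> mD c0 /(integral_le_enlarge measurable0 mD (@sub0set _ _) c0).
by rewrite integral_set0 add0e setD0.
Qed.

Lemma bound_ge0 : 0 <= C.
Proof. exact: le_trans (g0 0) (gC _). Qed.

Lemma negligible_gt_bound D :
  mu.-negligible (D `&` [set y | C < g y]).
Proof.
rewrite (_ : _ `&` _ = set0); first exact: negligible_set0.
by apply/seteqP; split => // y [_ /=]; rewrite ltNge gC.
Qed.

Lemma massE x r :
  (\int[mu]_(y in `[(x - r)%R, (x + r)%R]) (g y)%:E = (mass x r)%:E)%E.
Proof.
rewrite /mass fineK//.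
have [r0|r0] := ltP r 0.
  by rewrite set_itv_ge ?integral_set0// -leNgt bnd_simp; lra.
rewrite ge0_fin_numE; last by apply: integral_ge0 => y _; rewrite lee_fin.
apply: le_lt_trans (integral_le_bound (measurable_itv_completed _) bound_ge0
  (negligible_gt_bound _)) _.
by rewrite completed_measure_itvcc ?ltry//; lra.
Qed.

Lemma mass_ge0 x r : 0 <= mass x r.
Proof.
by rewrite -lee_fin -massE; apply: integral_ge0 => y _; rewrite lee_fin.
Qed.

Lemma mass_le_sub x y r s : `|x - y| + r <= s -> mass x r <= mass y s.
Proof.
move=> h; rewrite -lee_fin -!massE; apply: ge0_subset_integral.
- exact: measurable_itv_completed.
- exact: measurable_itv_completed.
- by apply/measurable_EFinP; exact: measurable_funTS.
- by move=> z _; rewrite lee_fin.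
exact: itvcc_center_sub.
Qed.

Lemma mass_enlarge c x r s : 0 <= r -> r <= s -> 0 <= c ->
  mu.-negligible (`[x - s, x + s] `&` [set y | c < g y]) ->
  mass x s <= mass x r + c * (2 * (s - r)).
Proof.
move=> r0 rs c0 gc; rewrite -lee_fin EFinD EFinM -!massE.
have rsS : `[x - r, x + r]%classic `<=` `[x - s, x + s]%classic.
  by apply: itvcc_center_sub; rewrite subrr normr0 add0r.
have := integral_le_enlarge (measurable_itv_completed _)
  (measurable_itv_completed _) rsS c0 gc.
rewrite measureD ?setIidr//; last 3 first.
- exact: measurable_itv_completed.
- exact: measurable_itv_completed.
- by rewrite [ltLHS]completed_measure_itvcc ?ltry//; lra.
have -> : (2 * (s - r))%:E =
    (((x + s) - (x - s))%:E - ((x + r) - (x - r))%:E)%E.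
  by rewrite -EFinB; congr EFin; lra.
by rewrite -!completed_measure_itvcc//; lra.
Qed.

Lemma mass_le c x r : 0 <= r -> 0 <= c ->
  mu.-negligible (`[x - r, x + r] `&` [set y | c < g y]) ->
  mass x r <= c * (2 * r).
Proof.
move=> r0 c0 gc; rewrite -lee_fin EFinM -massE.
have -> : (2 * r)%:E = mu `[x - r, x + r]%classic.
  by rewrite completed_measure_itvcc; [congr EFin|]; lra.
exact: integral_le_bound (measurable_itv_completed _) c0 gc.
Qed.

(** Only the part of the interval inside A, where g = c, is kept; density
    points of A make this bound sharp at small radii. *)
Lemma mass_ge_measure c x r A : measurable A -> 0 <= c ->
  (forall y, A y -> g y = c) ->
  (c%:E * mu (A `&` `[(x - r)%R, (x + r)%R]) <= (mass x r)%:E)%E.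
Proof.
move=> mA c0 Ac; rewrite -massE -integral_cst; last first.
  by apply: measurableI => //; exact: measurable_itv_completed.
have mgE B : measurable_fun B (EFin \o g).
  by apply/measurable_EFinP; exact: measurable_funTS.
rewrite (@eq_integral _ _ _ mu (A `&` `[x - r, x + r]) (EFin \o g)); last first.
  by move=> y /[!inE] -[/Ac] /= ->.
apply: ge0_subset_integral => //.
- by apply: measurableI => //; exact: measurable_itv_completed.
- exact: measurable_itv_completed.
- by move=> y _; rewrite lee_fin.
Qed.

Lemma avgE x r :
  avg r g x = (mass x r / (2 * r))%:E.
Proof.
rewrite /avg [mass x r / _]mulrC EFinM -massE; congr (_ * _)%E.
rewrite -[RHS](@integral_completed_translate _ x _ (EFin \o g)
  (measurable_itv_completed _)); last 2 first.
- by apply/measurable_EFinP; exact: measurable_funTS.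
- by move=> y; rewrite lee_fin.
have E : +%R x @^-1` `[x - r, x + r] = `[- r, r]%classic.
  by apply/seteqP; split => y /=; rewrite !in_itv/= => /andP[? ?];
    apply/andP; split; lra.
by rewrite E.
Qed.

End mass.

(** * Density points of Lebesgue-measurable sets *)

Section density.
Context {R : realType}.
Implicit Types (A : set (lebesgueR R)) (I : set R).
Local Notation mu := (@completed_lebesgue_measure R).

Lemma negligible_borel_completed I :
  (@lebesgue_measure R).-negligible I -> mu.-negligible I.
Proof.
move=> [B [mB B0 IB]]; exists B; split => //.
exact: measurable_borel_completed.
Qed.

(** A Lebesgue-measurable set is a Borel set X up to a null set, and almost
    every point of X is a density point of X. If no point of A in I were good,
    all of them would lie in one of the two exceptional null sets. *)
Lemma completed_density A I :
  measurable A -> ~ mu.-negligible (I `&` A) ->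
  exists2 y, (I `&` A) y & forall eta : R, eta < 1 ->
    exists2 r : R, 0 < r &
      ((eta * (2 * r))%:E <= mu (A `&` `[(y - r)%R, (y + r)%R]))%E.
Proof.
move=> mA.
have : ((@wlength R idfun)^*%mu).-cara.-measurable A by [].
rewrite -completed_caratheodory_measurable g_sigma_completed_algebra_genE.
move=> {mA}[X mX [N negN <-{A}]] notneg.
have densX := lebesgue_density mX.
apply: contrapT => /forall2NP nogood; apply: notneg.
apply: negligible_borel_completed.
apply: negligibleS (negligibleU densX negN) => y [Iy [Xy|Ny]]; last by right.
left => /= dens.
have [ny|] := nogood y; first by apply: ny; split => //; left.
apply => eta eta1.
have {}dens : \forall r \near 0^'+,
    (eta%:E <
      lebesgue_measure (X `&` ball y r) / lebesgue_measure (ball y r))%E.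
  apply: (dens [set z | (eta%:E < z)%E]); rewrite indicE mem_set//.
  by apply: open_ereal_gt'; rewrite lte_fin.
near (0 : R)^'+ => r; exists r; first by near: r; exact: nbhs_right_gt.
have r0 : 0 < r by near: r; exact: nbhs_right_gt.
have : (eta%:E <
    lebesgue_measure (X `&` ball y r) / lebesgue_measure (ball y r))%E.
  by near: r.
have -> : lebesgue_measure (ball y r) = (2 * r)%:E.
  by rewrite lebesgue_measure_ball ?ltW// mulr_natl.
rewrite inver gt_eqF; last lra.
rewrite lte_pdivlMr; last lra.
rewrite -EFinM => /ltW /le_trans; apply.
have -> : lebesgue_measure (X `&` ball y r) = mu (X `&` ball y r) by [].
apply: le_outer_measure => z [Xz]; rewrite ball_itv/= !in_itv/= => /andP[z1 z2].
by split; [left|apply/andP; split; lra].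
Unshelve. all: by end_near. Qed.

End density.

(** * The largest value taken near a point *)

(** Here J plays the part of an ideal of negligible sets. The values are
    examined one by one, keeping the largest whose level set is not in J. *)
Lemma exists_top_value {R : realType} (T : Type) (J : set (set T)) (g : T -> R)
    (s : seq R) :
  (forall A B, A `<=` B -> J B -> J A) ->
  (forall A B, J A -> J B -> J (A `|` B)) -> J set0 ->
  ~ J [set y | g y \in s] ->
  exists2 c, ~ J [set y | g y = c] & J [set y | g y \in s /\ c < g y].
Proof.
move=> JS JU J0; elim: s => [|v s IH] notJ.
  by case: notJ; apply: JS J0 => y.
have vsE : [set y | g y \in v :: s] = [set y | g y = v] `|` [set y | g y \in s].
  by apply/seteqP; split => y /=; rewrite inE => /predU1P.
have [Js|/IH[c notJc Jc]] := pselect (J [set y | g y \in s]).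
  exists v; first by move=> Jv; apply: notJ; rewrite vsE; exact: JU.
  by apply: JS Js => y [] /=; rewrite inE => /predU1P[->|//]; rewrite ltxx.
have [vc|cv] := leP v c.
  exists c => //; apply: JS Jc => y [] /=; rewrite inE => /predU1P[->|//].
  by rewrite ltNge vc.
have [Jv|notJv] := pselect (J [set y | g y = v]).
  exists c => //; apply: JS (JU _ _ Jv Jc) => y [] /=.
  by rewrite inE => /predU1P[|]; [left|right].
exists v => //; apply: JS Jc => y [] /=; rewrite inE => /predU1P[->|].
  by rewrite ltxx.
by move=> ys vy; split => //; exact: lt_trans vy.
Qed.

Section local_top_value.
Context {R : realType}.
Local Notation mu := (@completed_lebesgue_measure R).

(** [exists_top_value] for the ideal of sets that are null in some
    neighbourhood of x; the whole line is not in it. *)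
Lemma exists_local_top_value (g : lebesgueR R -> R) (s : seq R) (x : R) :
  (forall y, g y \in s) ->
  exists c d : R,
    [/\ 0 < d, mu.-negligible (`[x - d, x + d] `&` [set y | c < g y]) &
      forall e, 0 < e ->
        ~ mu.-negligible (`[x - e, x + e] `&` [set y | g y = c])].
Proof.
move=> gs.
pose locally_null (A : set (lebesgueR R)) :=
  exists2 d : R, 0 < d & mu.-negligible (`[x - d, x + d] `&` A).
have nullS A B : A `<=` B -> locally_null B -> locally_null A.
  by move=> AB [d d0 dB]; exists d => //; apply: negligibleS dB; exact: setIS.
have nullU A B : locally_null A -> locally_null B -> locally_null (A `|` B).
  move=> [d d0 dA] [e e0 eB]; exists (Num.min d e); first by rewrite lt_min d0.
  rewrite setIUr; apply: negligibleU.
    apply: negligibleS dA; apply: setSI; apply: itvcc_center_sub.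
    by rewrite subrr normr0 add0r ge_min lexx.
  apply: negligibleS eB; apply: setSI; apply: itvcc_center_sub.
  by rewrite subrr normr0 add0r ge_min lexx orbT.
have null0 : locally_null set0.
  by exists 1 => //; rewrite setI0; exact: negligible_set0.
have [|c notnull [d d0 dnull]] :=
    @exists_top_value _ _ locally_null g s nullS nullU null0.
  move=> [d d0] dN.
  have : mu.-negligible `[x - d, x + d]%classic.
    by apply: negligibleS dN => y Iy; split => //=.
  move=> /negligibleP => /(_ (measurable_itv_completed _)).
  rewrite [LHS]completed_measure_itvcc; last lra.
  by move=> /eqP; rewrite eqe gt_eqF//; lra.
exists c, d; split => //.
  by apply: negligibleS dnull; apply: setIS => y /= cy; split.
by move=> e e0 eN; apply: notnull; exists e.
Qed.

End local_top_value.

(** * Averages *)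

(** Dividing by C + 1 instead of C makes room for C = 0. *)
Lemma mul_le_of_small {R : realFieldType} (C u t : R) :
  0 <= C -> 0 <= u -> u <= t / (C + 1) -> C * u <= t.
Proof.
move=> C0 u0; rewrite ler_pdivlMr ?ltr_wpDl// => h.
by apply: le_trans h; rewrite mulrDr mulr1 mulrC lerDl.
Qed.

Section averages.
Context {R : realType}.
Implicit Types (c r s x y : R).
Local Notation mu := (@completed_lebesgue_measure R).
Variables (g : lebesgueR R -> R) (C : R).
Hypothesis mg : measurable_fun setT g.
Hypotheses (g0 : forall y, 0 <= g y) (gC : forall y, g y <= C).

Definition average x r : R := mass g x r / (2 * r).

Lemma average_le c x r : 0 < r -> 0 <= c ->
  mu.-negligible (`[x - r, x + r] `&` [set y | c < g y]) -> average x r <= c.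
Proof.
move=> r0 c0 gc; rewrite /average ler_pdivrMr ?mulr_gt0//.
by apply: (mass_le mg g0 gC) => //; exact: ltW.
Qed.

Lemma average_le_bound x r : 0 < r -> average x r <= C.
Proof.
move=> r0; apply: average_le => //; first exact: bound_ge0 g0 gC.
exact: (negligible_gt_bound gC).
Qed.

(** The interval of radius r about y lies in the one of radius r + |y - x|
    about x, whose two additional pieces contribute at most 2 C |y - x|. *)
Lemma average_lipschitz x y r : 0 < r ->
  average y r <= average x r + C * `|y - x| / r.
Proof.
move=> r0; have d0 := normr_ge0 (y - x).
have h1 : mass g y r <= mass g x (`|y - x| + r).
  by apply: (mass_le_sub mg g0 gC).
have : mass g x (`|y - x| + r) <= mass g x r + C * (2 * (`|y - x| + r - r)).
  apply: (mass_enlarge mg g0 gC); [exact: ltW|by rewrite lerDr| |].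
    exact: bound_ge0 g0 gC.
  exact: (negligible_gt_bound gC).
move=> /(le_trans h1) h2; rewrite /average ler_pdivrMr ?mulr_gt0//.
apply: le_trans h2 _; rewrite le_eqVlt; apply/orP; left; apply/eqP.
by field; rewrite gt_eqF.
Qed.

End averages.

(** * The maximal function and its maximizing radii *)

Section maximal_function.
Context {R : realType}.
Implicit Types (c r s x y : R).
Local Notation mu := (@completed_lebesgue_measure R).
Variables (f : lebesgueR R -> R) (C : R).
Hypothesis mf : measurable_fun setT f.
Hypothesis fC : forall y, `|f y| <= C.

Local Notation g := (fun y : lebesgueR R => `|f y|).
Local Notation a := (average g).

Definition maximalr x : R := fine (maximal f x).
Local Notation m := maximalr.

Let mg : measurable_fun setT g.
Proof. exact: measurableT_comp. Qed.

Let g0 y : 0 <= g y. Proof. exact: normr_ge0. Qed.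

Let C0 : 0 <= C. Proof. exact: bound_ge0 g0 fC. Qed.

Let avgfE x r : avg r g x = (a x r)%:E.
Proof. exact: avgE mg g0 fC _ _. Qed.

Lemma maximalE x : maximal f x = (m x)%:E.
Proof.
rewrite /maximalr fineK// fin_numE; apply/andP; split.
  have : (avg 1 g x <= maximal f x)%E.
    by apply: ereal_sup_ubound; exists 1 => /=.
  by rewrite avgfE; case: maximal.
have : (maximal f x <= C%:E)%E.
  apply: ge_ereal_sup => _ [r /= r0 <-].
  by rewrite avgfE lee_fin (average_le_bound mg g0 fC).
by case: maximal.
Qed.

Lemma maximalr_ub x r : 0 < r -> a x r <= m x.
Proof.
move=> r0; rewrite -lee_fin -maximalE -avgfE.
by apply: ereal_sup_ubound; exists r.
Qed.

Lemma maximalr_lub x c : (forall r, 0 < r -> a x r <= c) -> m x <= c.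
Proof.
move=> h; rewrite -lee_fin -maximalE; apply: ge_ereal_sup => _ [r /= r0 <-].
by rewrite avgfE lee_fin; exact: h.
Qed.

(** The threshold d / 2 separates the radii at which the bound c applies, as the
    interval stays in [x - d, x + d], from those at which averages move slowly
    with their centre. *)
Lemma maximal_continuous c x d : 0 <= c -> 0 < d ->
  mu.-negligible (`[x - d, x + d] `&` [set y | c < g y]) ->
  (c%:E <= maximal f x)%E -> {for x, continuous (maximal f : R -> \bar R)}.
Proof.
move=> c0 d0 gc; rewrite maximalE lee_fin => cm.
have -> : (maximal f : R -> \bar R) = EFin \o m.
  by apply/funext => y; exact: maximalE.
apply: cvg_EFin; first exact: nearW.
apply/(@cvgrPdist_le _ R^o) => e e0.
have [r r0 hr] : exists2 r, 0 < r & m x - e / 2 < a x r.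
  apply: contrapT => /forall2NP h.
  have : m x <= m x - e / 2.
    by apply: maximalr_lub => r r0; have [//|/negP] := h r; rewrite -leNgt.
  lra.
near=> y; rewrite ler_distl /=.
have yd : `|y - x| < d / 2.
  by rewrite distrC; near: y; apply: cvgr_dist_lt => //; rewrite divr_gt0.
have yde : C * `|y - x| <= e * (d / 2).
  apply: mul_le_of_small => //; rewrite distrC; near: y.
  apply: cvgr_dist_le => //.
  by rewrite !divr_gt0 ?mulr_gt0 ?divr_gt0// ltr_wpDl.
have yr : C * `|x - y| <= e / 2 * r.
  apply: mul_le_of_small => //; near: y.
  apply: cvgr_dist_le => //.
  by rewrite !divr_gt0 ?mulr_gt0 ?divr_gt0// ltr_wpDl.
(* Lower semicontinuity: a nearly optimal radius at x serves for y too. *)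
have low : m x <= m y + e.
  have Ce : C * `|x - y| / r <= e / 2 by rewrite ler_pdivrMr.
  have := le_trans (average_lipschitz mg g0 fC y x r0)
    (lerD (maximalr_ub y r0) Ce).
  by move=> /(lt_le_trans hr)/ltW; rewrite lerBlDr -addrA -splitr.
have up : m y <= m x + e.
  apply: maximalr_lub => s s0; have [sd|ds] := ltP s (d / 2).
    apply: (@le_trans _ _ c); last by apply: (le_trans cm); rewrite lerDl ltW.
    apply: (average_le mg g0 fC) => //; apply: negligibleS gc; apply: setSI.
    by apply: itvcc_center_sub; rewrite [leRHS]splitr lerD// ltW.
  apply: le_trans (average_lipschitz mg g0 fC x y s0) _.
  apply: lerD; first exact: maximalr_ub.
  by rewrite ler_pdivrMr//; apply: le_trans yde _; rewrite ler_pM2l.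
rewrite lerBlDr up; exact: low.
Unshelve. all: by end_near. Qed.

(** The assumption on C |y - x| keeps averages at y of radius at least d / 2
    below c, given that those at x are at most M x. As M y >= c, the radii that
    remain give M y = c and are the only ones that can be maximizing. *)
Lemma frequency_eq0 c x d y : 0 <= c -> 0 < d ->
  mu.-negligible (`[x - d, x + d] `&` [set y | c < g y]) ->
  `|y - x| < d / 2 -> C * `|y - x| < (c - m x) * (d / 2) -> c <= m y ->
  frequency f y = 0.
Proof.
move=> c0 d0 gc yd yC cm; rewrite /frequency; case: pselect => // -[r0 Er0].
have small_le s : 0 < s -> s < d / 2 ->
    mu.-negligible (`[y - s, y + s] `&` [set y | c < g y]).
  move=> s0 sd; apply: negligibleS gc; apply: setSI.
  by apply: itvcc_center_sub; rewrite [leRHS]splitr lerD// ltW.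
have d2_gt0 : 0 < d / 2 by rewrite divr_gt0.
have large_lt s : d / 2 <= s -> a y s < c.
  move=> ds; have s0 : 0 < s := lt_le_trans d2_gt0 ds.
  apply: le_lt_trans (average_lipschitz mg g0 fC x y s0) _.
  rewrite -[ltRHS](subrKC (m x)); apply: ler_ltD; first exact: maximalr_ub.
  rewrite ltr_pdivrMr//; apply: (lt_le_trans yC); rewrite ler_wpM2l//.
  rewrite -(pmulr_lge0 (c - m x) d2_gt0).
  by apply: le_trans (ltW yC); rewrite mulr_ge0.
have mc : m y = c.
  apply/eqP; rewrite eq_le cm andbT; apply: maximalr_lub => s s0.
  have [sd|/large_lt/ltW//] := ltP s (d / 2).
  by apply: (average_le mg g0 fC) => //; exact: small_le.
have radP s : maximizing_radii f y s <-> 0 < s /\ a y s = c.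
  rewrite /maximizing_radii /= maximalE mc avgfE.
  by split=> -[s0] => [[->]|<-].
have [r0_gt0 ar0] := (radP r0).1 Er0.
have r0d : r0 < d / 2.
  by rewrite ltNge; apply/negP => /large_lt; rewrite ar0 ltxx.
(* Passing from radius s to r0 adds at most c per unit of length, so an average
   equal to c at r0 leaves an average of at least c at s. *)
have down s : 0 < s -> s <= r0 -> maximizing_radii f y s.
  move=> s0 sr; apply/radP; split => //; apply/eqP.
  rewrite eq_le -{1}mc maximalr_ub//=.
  have := mass_enlarge mg g0 fC (ltW s0) sr c0 (small_le _ r0_gt0 r0d).
  have -> : mass g y r0 = c * (2 * r0).
    by rewrite -ar0 /average; field; rewrite gt_eqF.
  rewrite /average ler_pdivlMr ?mulr_gt0//.
  have -> : c * (2 * s) = c * (2 * r0) - c * (2 * (r0 - s)) by ring.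
  by rewrite lerBlDr.
have lb0 : lbound (maximizing_radii f y) 0 by move=> s [/ltW].
apply/eqP; rewrite eq_le; apply/andP; split; last first.
  by apply: lb_le_inf => //; exists r0.
apply/ler_addgt0Pr => e e0; rewrite add0r.
apply: le_trans (_ : Num.min e r0 <= e).
  apply: ge_inf; first by exists 0.
  apply: down; first by rewrite lt_min e0.
  by rewrite ge_min lexx orbT.
by rewrite ge_min lexx.
Qed.

(** At a density point of the set where g = c, averages of small radius are
    larger than any given number below c. *)
Lemma maximal_ge_near c x rho : 0 <= c -> 0 < rho ->
  measurable [set y | g y = c] ->
  ~ mu.-negligible (`[x - rho, x + rho] `&` [set y | g y = c]) ->
  exists2 y, `|y - x| <= rho & c <= m y.
Proof.
move=> c0 rho0 mc notneg; have [y [Iy gy] dens] := completed_density mc notneg.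
exists y.
  by move: Iy; rewrite /= in_itv/= ler_distl.
rewrite leNgt; apply/negP => mc_lt.
have c_gt0 : 0 < c.
  apply: le_lt_trans mc_lt; apply: le_trans (maximalr_ub y ltr01).
  by rewrite /average divr_ge0 ?mulr_ge0// (mass_ge0 mg g0 fC).
(* The density is chosen so that c times it is the midpoint of M y and c. *)
have [|r r0 dr] := dens ((m y / c + 1) / 2).
  suff : m y / c < 1 by lra.
  by rewrite ltr_pdivrMr// mul1r.
have := maximalr_ub y r0; rewrite leNgt => /negP; apply.
have := mass_ge_measure mg g0 fC y r mc c0 (fun z => id).
move=> /(le_trans (lee_wpmul2l _ dr)); rewrite lee_fin => /(_ c0).
rewrite -EFinM lee_fin => h.
rewrite /average ltr_pdivlMr ?mulr_gt0//; apply: lt_le_trans h.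
rewrite [ltRHS]mulrA ltr_pM2r ?mulr_gt0//.
have -> : c * ((m y / c + 1) / 2) = (m y + c) / 2.
  by field; rewrite gt_eqF.
by rewrite midf_lt.
Qed.

End maximal_function.

(** * Discontinuities of the maximal function *)

Theorem theorem5 (R : realType) (f : {sfun lebesgueR R >-> R})
    (f_L1 : (@completed_lebesgue_measure R).-integrable setT (EFin \o f))
    (x : R) (Mf_disc : ~ {for x, continuous (maximal f : R -> \bar R)}) :
  forall r : R, 0 < r ->
    exists2 y : R, y \in `]x - r, x + r[ & frequency f y = 0.
Proof.
move=> r r0.
have mf : measurable_fun [set: lebesgueR R] f by exact: measurable_funPT.
have [C fC] : exists C, forall y, `|f y| <= C.
  have [M [_ Mf]] := simple_bounded f.
  by exists (M + 1) => y; apply: Mf => //; rewrite ltrDl.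
have [s fs] : exists s : seq R, range f = [set` s] by exact/finite_seqP/fimfunP.
have [|c [d [d0 dnull notnull]]] := @exists_local_top_value _
    (fun y => `|f y|) [seq `|v| | v <- s] x.
  by move=> y; apply: map_f; have : range f (f y) by []; rewrite fs.
have c0 : 0 <= c.
  rewrite leNgt; apply/negP => c0; apply: (notnull 1) => //.
  rewrite (_ : _ `&` _ = set0); first exact: negligible_set0.
  apply/seteqP; split => // y [_ /= yc].
  by move: c0; rewrite -yc ltNge normr_ge0.
have mx_lt : maximalr f x < c.
  rewrite ltNge; apply/negP => cm; apply: Mf_disc.
  apply: (maximal_continuous mf fC c0 d0 dnull).
  by rewrite (maximalE mf fC) lee_fin.
have C0 : 0 <= C by exact: le_trans (normr_ge0 _) (fC 0).
(* d / 4 leaves room for the strict inequalities with d / 2 below. *)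
pose t := (c - maximalr f x) * (d / 4).
have t0 : 0 < t by rewrite mulr_gt0 ?subr_gt0 ?divr_gt0.
pose rho := Num.min (r / 2) (Num.min (d / 4) (t / (C + 1))).
have rho0 : 0 < rho.
  by rewrite !lt_min !divr_gt0 ?ltr_wpDl.
have mc : measurable [set y : lebesgueR R | `|f y| = c].
  have mg : measurable_fun [set: lebesgueR R] (fun y => `|f y|).
    exact: measurableT_comp.
  by have := mg measurableT [set c] (measurable_set1 _); rewrite setTI.
have [y yx cy] := maximal_ge_near mf fC c0 rho0 mc (notnull _ rho0).
move: yx; rewrite !le_min => /andP[yr /andP[yd yt]].
exists y.
  rewrite in_itv/= -ltr_distl; apply: le_lt_trans yr _.
  by rewrite ltr_pdivrMr// ltr_pMr// ltr1n.
apply: (frequency_eq0 mf fC c0 d0 dnull) => //.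
  by apply: le_lt_trans yd _; lra.
apply: le_lt_trans (mul_le_of_small C0 (normr_ge0 _) yt) _.
by rewrite /t ltr_pM2l ?subr_gt0//; lra.
Qed.
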